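(* Let $0<\alpha<1$ and let $f(z)=\sum_{n=0}^\infty a_n z^n$ be a function in the class $\mathcal{B}$. Then $$\sum_{n=0}^\infty \frac{\Gamma(n+1)}{\Gamma(n+1-\alpha)}\,|a_n|\, r^{n-\alpha} \;\le\; \frac{r^{-\alpha}}{\Gamma(1-\alpha)}\qquad\text{for all } 0<r\le R(\alpha),$$ where $R(\alpha)$ is the minimum positive solution $r\in(0,1)$ of $$\sum_{n=1}^\infty \frac{\Gamma(n+1)}{\Gamma(n+1-\alpha)}\, r^n = \frac{1}{2\,\Gamma(1-\alpha)}.$$
   Context: $\mathbb{D}=\{z\in\mathbb{C}:|z|<1\}$. $\mathcal{B}$ denotes the class of analytic functions $f(z)=\sum_{n=0}^\infty a_nz^n$ in $\mathbb{D}$ such that $|f(z)|<1$ for all $z\in\mathbb{D}$. $\Gamma$ is the Gamma function. The left-hand side is the majorant series (Bohr sum) of the Riemann–Liouville fractional derivative $D^\alpha f(z)=\sum_{n=0}^\infty a_n\frac{\Gamma(n+1)}{\Gamma(n+1-\alpha)}z^{n-\alpha}$, with $r=|z|$. *)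

(* Defs.v *)
From Stdlib Require Import Reals.
From Coquelicot Require Import Coquelicot.

Open Scope R_scope.

(* Euler's integral, improper at both ends.  It converges exactly for x > 0,
   so this is the Gamma function only on the positive half-line. *)
Definition Gamma (x : R) : R :=
  RInt_gen (fun t => Rpower t (x - 1) * exp (- t))
    (at_right 0) (Rbar_locally p_infty).

(* Riemann-Liouville factor: D^alpha z^n = frac_coef alpha n * z^(n - alpha).
   Both Gamma arguments are positive when alpha < 1. *)
Definition frac_coef (alpha : R) (n : nat) : R :=
  Gamma (INR n + 1) / Gamma (INR n + 1 - alpha).

Definition expands_on_disk (f : C -> C) (a : nat -> C) : Prop :=
  forall z : C, Cmod z < 1 ->
    is_pseries (K := C_AbsRing) (V := C_NormedModule) a z (f z).

(* Only the values of f on the unit disk matter; analyticity there is the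
   existence of an expansion at 0 converging on the whole disk. *)
Definition class_B (f : C -> C) : Prop :=
  (exists a : nat -> C, expands_on_disk f a) /\
  (forall z : C, Cmod z < 1 -> Cmod (f z) < 1).

Definition radius_equation (alpha r : R) : Prop :=
  is_series (fun k : nat => frac_coef alpha (S k) * r ^ S k)
    (1 / (2 * Gamma (1 - alpha))).

Definition is_bohr_radius (alpha r : R) : Prop :=
  0 < r < 1 /\ radius_equation alpha r /\
  forall s : R, 0 < s < 1 -> radius_equation alpha s -> r <= s.

(* Main.v *)
(* The majorant sum is r^-alpha * sum_n c_n |a_n| r^n with c_n = frac_coef alpha n.
   The coefficients of f satisfy |a_n| <= 2 (1 - |a_0|) for n >= 1, obtained by
   averaging truncations of f on a circle against the weight 1 + Re (u z^-n).
   Hence for r <= R(alpha) the sum is at most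
   c_0 |a_0| + 2 (1 - |a_0|) * (c_0 / 2) = c_0 = 1 / Gamma (1 - alpha).
   The radius exists because c_n >= c_0 makes sum_(n >= 1) c_n r^n reach c_0
   at r = 1/2, and is unique because that sum is strictly increasing; the
   functional equation of Gamma gives c_(n+1) / c_n = (n+1) / (n+1-alpha). *)
Require Import Defs.
From Stdlib Require Import Reals Lra Lia.
From Coquelicot Require Import Coquelicot.
Open Scope R_scope.

(** * The Gamma function on the positive half-line *)

Lemma near_zero_infinity (P : R -> R -> Prop) (a0 b0 : R) :
  0 < a0 -> (forall a b, 0 < a < a0 -> b0 < b -> P a b) ->
  filter_prod (at_right 0) (Rbar_locally p_infty) (fun ab => P (fst ab) (snd ab)).
Proof.
intros Ha0 HP.
apply (Filter_prod _ _ _ (fun a => 0 < a < a0) (fun b => b0 < b)).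
- exists (mkposreal a0 Ha0); intros y Hy Hy0.
  change (Rabs (y - 0) < a0) in Hy; apply Rabs_lt_between in Hy; lra.
- now exists b0.
- intros a b; apply HP.
Qed.

(* The improper integral is the supremum of the proper ones. *)
Lemma is_RInt_gen_bounded (f : R -> R) (K : R) :
  (forall t, 0 < t -> continuous f t) ->
  (forall t, 0 < t -> 0 < f t) ->
  (forall a b, 0 < a <= b -> RInt f a b <= K) ->
  exists v, 0 < v /\ is_RInt_gen f (at_right 0) (Rbar_locally p_infty) v.
Proof.
intros Hc Hpos HK.
assert (Hex : forall a b, 0 < a -> 0 < b -> ex_RInt f a b).
{ intros a b Ha Hb; apply (ex_RInt_continuous (V := R_CompleteNormedModule)); intros z Hz; apply Hc.
  apply Rlt_le_trans with (2 := proj1 Hz); apply Rmin_case; assumption. }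
assert (H0 : forall a b, 0 < a <= b -> 0 <= RInt f a b).
{ intros a b Hab; apply RInt_ge_0; [lra | apply Hex; lra |].
  intros x Hx; apply Rlt_le, Hpos; lra. }
set (E := fun y => exists a b, 0 < a <= b /\ y = RInt f a b).
destruct (completeness E) as [v [Hub Hlub]].
- exists K; intros y (a & b & Hab & ->); now apply HK.
- exists (RInt f 1 1), 1, 1; split; [lra | reflexivity].
- assert (Hv : 0 < v).
  { apply Rlt_le_trans with (RInt f 1 2).
    - apply RInt_gt_0; [lra | |]; intros x Hx; [apply Hpos | apply Hc]; lra.
    - apply Hub; exists 1, 2; split; [lra | reflexivity]. }
  exists v; split; [exact Hv |].
  intros P [eps HP].
  (* Since v is the least upper bound, v - eps is exceeded by some proper integral. As f > 0,
     widening that interval only increases the integral, so every wider one stays in (v - eps,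
     v]. *)
  assert (Hex0 : exists a0 b0, 0 < a0 <= b0 /\ v - eps < RInt f a0 b0).
  { apply Classical_Prop.NNPP; intros Hn.
    assert (v <= v - eps).
    { apply Hlub; intros y (a & b & Hab & ->).
      destruct (Rle_lt_dec (RInt f a b) (v - eps)) as [H|H]; [exact H |].
      exfalso; apply Hn; now exists a, b. }
    destruct eps as [e He]; simpl in *; lra. }
  destruct Hex0 as (a0 & b0 & Hab0 & Hlow).
  refine (near_zero_infinity
    (fun a b => exists y, is_RInt f a b y /\ P y) a0 b0 (proj1 Hab0) _).
  intros a b Ha Hb.
  exists (RInt f a b); split.
  + apply (RInt_correct (V := R_CompleteNormedModule)), Hex; lra.
  + apply HP.
    change (Rabs (RInt f a b - v) < eps).
    assert (RInt f a b <= v) by (apply Hub; exists a, b; split; [lra | reflexivity]).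
    assert (RInt f a0 b0 <= RInt f a b).
    { rewrite <- (RInt_Chasles f a a0 b), <- (RInt_Chasles f a0 b0 b);
        try (apply Hex; lra).
      assert (0 <= RInt f a a0) by (apply H0; lra).
      assert (0 <= RInt f b0 b) by (apply H0; lra).
      unfold plus; simpl; lra. }
    apply Rabs_lt_between; destruct eps as [e He]; simpl in *; lra.
Qed.

Definition gamma_integrand (x t : R) : R := Rpower t (x - 1) * exp (- t).

Lemma gamma_integrand_pos (x t : R) : 0 < gamma_integrand x t.
Proof. apply Rmult_lt_0_compat; apply exp_pos. Qed.

(** Differential form of the integration by parts behind Gamma (x + 1) = x Gamma x. It also supplies
    the antiderivative that bounds the integral for small x. *)
Lemma is_derive_gamma_integrand (x t : R) : 0 < t ->
  is_derive (gamma_integrand (x + 1)) t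
    (x * gamma_integrand x t - gamma_integrand (x + 1) t).
Proof.
intros Ht; unfold gamma_integrand, Rpower.
auto_derive; [exact Ht |].
replace (x + 1 - 1) with x by ring.
replace ((x - 1) * ln t) with (x * ln t + - ln t) by ring.
rewrite exp_plus, (exp_Ropp (ln t)), exp_ln by exact Ht.
field; lra.
Qed.

Lemma continuous_gamma_integrand (x t : R) : 0 < t ->
  continuous (gamma_integrand x) t.
Proof.
intros Ht; apply (ex_derive_continuous (K := R_AbsRing) (V := R_NormedModule)).
unfold gamma_integrand, Rpower; auto_derive; exact Ht.
Qed.

(** Squeeze between 0 and t^x = exp (x ln t), whose exponent tends to minus infinity because x >
    0. *)
Lemma gamma_integrand_at_0 (x : R) : 0 < x ->
  filterlim (gamma_integrand (x + 1)) (at_right 0) (locally 0).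
Proof.
intros Hx.
assert (Hp : filterlim (fun t => x * ln t) (at_right 0) (Rbar_locally m_infty)).
{ eapply filterlim_comp; [apply is_lim_ln_0 |].
  pose proof (filterlim_Rbar_mult_l x m_infty) as Hm.
  replace (Rbar_mult x m_infty) with m_infty in Hm; [exact Hm |].
  simpl; destruct (Rle_dec 0 x) as [h|h]; [|lra].
  destruct (Rle_lt_or_eq_dec 0 x h); [reflexivity | lra]. }
assert (Hq : filterlim (fun t => exp (x * ln t)) (at_right 0) (locally 0)).
{ eapply filterlim_comp; [exact Hp | apply is_lim_exp_m]. }
apply (filterlim_le_le (fun _ => 0) _ (fun t => exp (x * ln t)) 0).
- apply (filter_imp (fun t => 0 < t)).
  + intros t Ht; split; [apply Rlt_le, gamma_integrand_pos |].
    unfold gamma_integrand, Rpower; replace (x + 1 - 1) with x by ring.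
    rewrite <- (Rmult_1_r (exp (x * ln t))) at 2.
    apply Rmult_le_compat_l; [apply Rlt_le, exp_pos |].
    rewrite <- exp_0; apply Rlt_le, exp_increasing; lra.
  + exists (mkposreal 1 Rlt_0_1); intros y _ Hy; exact Hy.
- apply filterlim_const.
- exact Hq.
Qed.

(** The exponent (x - 1) ln t - t is factored as t ((x - 1) ln t / t - 1), whose second factor tends
    to -1. *)
Lemma gamma_integrand_at_infty (x : R) :
  filterlim (gamma_integrand x) (Rbar_locally p_infty) (locally 0).
Proof.
apply (is_lim_ext_loc (fun t => exp (t * ((x - 1) * (ln t / t) - 1))) _ p_infty 0).
- exists 0; intros t Ht; unfold gamma_integrand, Rpower.
  rewrite <- exp_plus; f_equal; field; lra.
- apply (is_lim_comp exp _ p_infty 0 m_infty).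
  + apply is_lim_exp_m.
  + apply (is_lim_ext (fun t => t * ((x - 1) * (ln t / t) - 1))); [reflexivity |].
    assert (Hl : is_lim (fun t => (x - 1) * (ln t / t) - 1) p_infty (-1)).
    { replace (-1) with ((x - 1) * 0 - 1) by ring.
      apply is_lim_minus'; [| apply is_lim_const].
      apply (is_lim_scal_l (fun t => ln t / t) (x - 1) p_infty 0), is_lim_div_ln_p. }
    evar_last; [apply (is_lim_mult _ _ _ p_infty (-1)); [apply is_lim_id | exact Hl | simpl; lra] |].
    simpl; destruct (Rle_dec 0 (-1)) as [h|h]; [exfalso; lra | reflexivity].
  + exists 0; intros y _ Hy; discriminate.
Qed.

(** Convergence is proved directly only where t^x <= 1 + t is available; larger arguments are
    reached through the functional equation. *)
Lemma is_RInt_gen_gamma_small (x : R) : 0 < x <= 1 ->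
  exists v, 0 < v /\
    is_RInt_gen (gamma_integrand x) (at_right 0) (Rbar_locally p_infty) v.
Proof.
intros Hx.
apply (is_RInt_gen_bounded _ (3 / x)).
- intros t; apply continuous_gamma_integrand.
- intros t _; apply gamma_integrand_pos.
- assert (Hpow : forall t, 0 < t -> gamma_integrand (x + 1) t <= (1 + t) * exp (- t)).
  { intros t Ht; unfold gamma_integrand; apply Rmult_le_compat_r; [apply Rlt_le, exp_pos |].
    replace (x + 1 - 1) with x by ring.
    destruct (Rle_lt_dec t 1) as [H|H].
    - apply Rle_trans with 1; [|lra].
      unfold Rpower; rewrite <- exp_0.
      assert (ln t <= 0) by (rewrite <- ln_1; apply ln_le; lra).
      assert (x * ln t <= 0) by nra.
      destruct H1 as [H1|H1]; [apply Rlt_le, exp_increasing, H1 | rewrite H1; lra].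
    - apply Rle_trans with t; [|lra].
      rewrite <- (Rpower_1 t Ht) at 2; apply Rle_Rpower; lra. }
  assert (Hexp : forall t, 0 < t -> (1 + t) * exp (- t) <= 1).
  { intros t Ht; rewrite exp_Ropp.
    apply (Rmult_le_reg_r (exp t)); [apply exp_pos |].
    rewrite Rmult_assoc, Rinv_l by apply Rgt_not_eq, exp_pos.
    rewrite Rmult_1_l, Rmult_1_r; apply exp_ineq1_le. }
  intros a b Hab.
  (* From t^x <= 1 + t for 0 < x <= 1: the derivative k' of k dominates the
     integrand on the whole half-line, and k stays bounded. *)
  set (k := fun t => (gamma_integrand (x + 1) t - (2 + t) * exp (- t)) / x).
  set (k' := fun t => gamma_integrand x t
     + ((1 + t) * exp (- t) - gamma_integrand (x + 1) t) / x).
  assert (Hk : is_RInt k' a b (minus (k b) (k a))).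
  { rewrite <- (Rmin_left a b) in Hab by lra.
    apply (is_RInt_derive (V := R_CompleteNormedModule)); intros t Ht.
    - assert (Ht0 : 0 < t) by lra.
      pose proof (is_derive_gamma_integrand x t Ht0) as Hd.
      unfold k, k'; auto_derive; [eexists; exact Hd |].
      replace (Derive _ t) with (x * gamma_integrand x t - gamma_integrand (x + 1) t)
        by (symmetry; exact (is_derive_unique _ _ _ Hd)).
      field; lra.
    - assert (Ht0 : 0 < t) by lra.
      apply (continuous_plus (V := R_NormedModule)); [now apply continuous_gamma_integrand |].
      apply (continuous_scal_l (V := R_NormedModule) (fun t => (1 + t) * exp (- t) - gamma_integrand (x + 1) t) (/ x)).
      apply (continuous_minus (V := R_NormedModule)); [| now apply continuous_gamma_integrand].
      apply (ex_derive_continuous (K := R_AbsRing) (V := R_NormedModule)).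
      auto_derive; exact I. }
  apply Rle_trans with (RInt k' a b).
  + apply RInt_le; [lra | | eexists; exact Hk |].
    * apply (ex_RInt_continuous (V := R_CompleteNormedModule)); intros z Hz.
      apply continuous_gamma_integrand; rewrite Rmin_left in Hz; lra.
    * intros t Ht; unfold k'.
      assert (0 <= ((1 + t) * exp (- t) - gamma_integrand (x + 1) t) / x); [|lra].
      apply Rdiv_le_0_compat; [| lra].
      assert (Ht0 : 0 < t) by lra; specialize (Hpow t Ht0); lra.
  + rewrite (is_RInt_unique _ _ _ _ Hk).
    (* The constant is generous: k b < 0 by [Hpow], and - k a <= (2 + a) exp (- a) / x <= 2 / x by
       [Hexp]. *)
    change (k b - k a <= 3 / x); unfold k.
    assert (Ha0 : 0 < a) by lra; assert (Hb0 : 0 < b) by lra.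
    pose proof (Hpow b Hb0); pose proof (Hexp b Hb0); pose proof (Hexp a Ha0).
    pose proof (gamma_integrand_pos (x + 1) a).
    pose proof (exp_pos (- b)).
    assert (exp (- a) <= 1) by (rewrite <- exp_0; apply Rlt_le, exp_increasing; lra).
    unfold Rdiv; rewrite <- Rmult_minus_distr_r.
    apply Rmult_le_compat_r; [apply Rlt_le, Rinv_0_lt_compat; lra |].
    nra.
Qed.

Lemma Gamma_eq (x v : R) :
  is_RInt_gen (gamma_integrand x) (at_right 0) (Rbar_locally p_infty) v -> Gamma x = v.
Proof.
intros H.
change (RInt_gen (gamma_integrand x) (at_right 0) (Rbar_locally p_infty) = v).
now apply is_RInt_gen_unique.
Qed.

Lemma is_RInt_gen_Gamma (x : R) : 0 < x <= 1 ->
  is_RInt_gen (gamma_integrand x) (at_right 0) (Rbar_locally p_infty) (Gamma x).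
Proof.
intros Hx; destruct (is_RInt_gen_gamma_small x Hx) as (v & _ & Hv).
now rewrite (Gamma_eq _ _ Hv).
Qed.

Lemma Gamma_pos (x : R) : 0 < x <= 1 -> 0 < Gamma x.
Proof.
intros Hx; destruct (is_RInt_gen_gamma_small x Hx) as (v & Hv0 & Hv).
now rewrite (Gamma_eq _ _ Hv).
Qed.

Lemma positive_interval_eventually (P : R -> Prop) :
  (forall t, 0 < t -> P t) ->
  filter_prod (at_right 0) (Rbar_locally p_infty) (fun ab =>
    forall t, Rmin (fst ab) (snd ab) <= t <= Rmax (fst ab) (snd ab) -> P t).
Proof.
intros HP.
refine (near_zero_infinity (fun a b => forall t, Rmin a b <= t <= Rmax a b -> P t) 1 1 Rlt_0_1 _).
intros a b Ha Hb t Ht; apply HP.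
rewrite Rmin_left in Ht by lra; lra.
Qed.

(** Fundamental theorem of calculus on the open half-line: nothing is asked of F at 0 beyond its
    right limit. *)
Lemma is_RInt_gen_derive_positive (F f : R -> R) (l0 l1 : R) :
  (forall t, 0 < t -> is_derive F t (f t)) ->
  (forall t, 0 < t -> continuous f t) ->
  filterlim F (at_right 0) (locally l0) ->
  filterlim F (Rbar_locally p_infty) (locally l1) ->
  is_RInt_gen f (at_right 0) (Rbar_locally p_infty) (l1 - l0).
Proof.
intros HF Hf H0 H1.
assert (HD : forall t, 0 < t -> Derive F t = f t) by (intros t Ht; apply is_derive_unique; auto).
apply (is_RInt_gen_ext (V := R_NormedModule) (Derive F)).
- apply (filter_imp (fun ab => forall t, Rmin (fst ab) (snd ab) <= t <= Rmax (fst ab) (snd ab) -> Derive F t = f t)).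
  + intros ab H t Ht; apply H; lra.
  + now apply positive_interval_eventually.
- apply is_RInt_gen_Derive; try assumption.
  + apply positive_interval_eventually; intros t Ht; eexists; auto.
  + apply positive_interval_eventually; intros t Ht.
    apply (continuous_ext_loc (T := R_UniformSpace) (U := R_UniformSpace) (Derive F) f t); [| auto].
    exists (mkposreal t Ht); intros s Hs; symmetry; apply HD.
    change (Rabs (s - t) < t) in Hs; apply Rabs_lt_between in Hs; lra.
Qed.

(** The derivative of [gamma_integrand (x + 1)] integrates to 0, both boundary limits being 0.
    Subtracting it from x times the integrand at x leaves the integrand at x + 1. *)
Lemma is_RInt_gen_gamma_succ (x v : R) : 0 < x ->
  is_RInt_gen (gamma_integrand x) (at_right 0) (Rbar_locally p_infty) v ->
  is_RInt_gen (gamma_integrand (x + 1)) (at_right 0) (Rbar_locally p_infty) (x * v).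
Proof.
intros Hx Hv.
assert (Hd : is_RInt_gen (fun t => x * gamma_integrand x t - gamma_integrand (x + 1) t)
   (at_right 0) (Rbar_locally p_infty) (0 - 0)).
{ apply (is_RInt_gen_derive_positive (gamma_integrand (x + 1))).
  - intros; now apply is_derive_gamma_integrand.
  - intros t Ht. apply (continuous_minus (V := R_NormedModule)); [| now apply continuous_gamma_integrand].
    apply (continuous_scal_r (V := R_NormedModule) x (gamma_integrand x)); now apply continuous_gamma_integrand.
  - now apply gamma_integrand_at_0.
  - apply gamma_integrand_at_infty. }
apply (is_RInt_gen_scal (V := R_NormedModule) _ x) in Hv.
pose proof (is_RInt_gen_minus (V := R_NormedModule) _ _ _ _ Hv Hd) as H.
unfold minus, scal, plus, opp in H; simpl in H; unfold mult in H; simpl in H.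
replace (x * v + - (0 - 0)) with (x * v) in H by ring.
apply (is_RInt_gen_ext (V := R_NormedModule)) with (2 := H).
apply filter_forall; intros ab t _; change (x * gamma_integrand x t - (x * gamma_integrand x t - gamma_integrand (x + 1) t) = gamma_integrand (x + 1) t); ring.
Qed.

(** Every positive real is n + x with 0 < x <= 1, so induction on n gives convergence on the whole
    positive half-line. *)
Lemma is_RInt_gen_Gamma_shift (x : R) (n : nat) : 0 < x <= 1 ->
  is_RInt_gen (gamma_integrand (INR n + x)) (at_right 0) (Rbar_locally p_infty) (Gamma (INR n + x)).
Proof.
intros Hx; induction n as [|n IHn].
- simpl; rewrite Rplus_0_l; now apply is_RInt_gen_Gamma.
- assert (Hp : 0 < INR n + x) by (pose proof (pos_INR n); lra).
  apply is_RInt_gen_gamma_succ in IHn; [|exact Hp].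
  rewrite S_INR; replace (INR n + 1 + x) with (INR n + x + 1) by ring.
  now rewrite (Gamma_eq _ _ IHn).
Qed.

Lemma Gamma_succ (x : R) (n : nat) : 0 < x <= 1 ->
  Gamma (INR n + x + 1) = (INR n + x) * Gamma (INR n + x).
Proof.
intros Hx; apply Gamma_eq, is_RInt_gen_gamma_succ.
- pose proof (pos_INR n); lra.
- now apply is_RInt_gen_Gamma_shift.
Qed.

Lemma Gamma_pos_shift (x : R) (n : nat) : 0 < x <= 1 -> 0 < Gamma (INR n + x).
Proof.
intros Hx; induction n as [|n IHn].
- simpl; rewrite Rplus_0_l; now apply Gamma_pos.
- rewrite S_INR; replace (INR n + 1 + x) with (INR n + x + 1) by ring.
  rewrite Gamma_succ by exact Hx.
  apply Rmult_lt_0_compat; [pose proof (pos_INR n); lra | exact IHn].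
Qed.

Lemma Gamma_1 : Gamma 1 = 1.
Proof.
apply Gamma_eq.
(* The boundary values of - exp (- t): 0 at infinity, -1 at 0. *)
replace 1 with (0 - -1) at 2 by ring.
apply (is_RInt_gen_derive_positive (fun t => - exp (- t))).
- intros t Ht; unfold gamma_integrand.
  rewrite Rminus_diag, Rpower_O by exact Ht.
  auto_derive; [exact I | ring].
- intros t; apply continuous_gamma_integrand.
- assert (Hc : continuous (fun t => - exp (- t)) 0).
  { apply (ex_derive_continuous (K := R_AbsRing) (V := R_NormedModule)); auto_derive; exact I. }
  unfold continuous in Hc; rewrite Ropp_0, exp_0 in Hc.
  eapply filterlim_filter_le_1; [| exact Hc].
  intros P [d Hd]; exists d; auto.
- replace 0 with (- 0) by ring.
  apply (is_lim_opp _ p_infty 0).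
  apply (is_lim_comp exp _ p_infty 0 m_infty); [apply is_lim_exp_m | |].
  + apply (is_lim_opp _ p_infty p_infty), is_lim_id.
  + exists 0; intros y _ Hy; discriminate.
Qed.

(** * Coefficients of bounded analytic functions *)

(** Equalities coming from [sum_n] are typed in a carrier only convertible to [C]; retyping them
    lets [ring] and [field] apply. *)
Ltac as_C_equation := match goal with |- @eq _ ?x ?y => change (@eq C x y) end.

(** The rotation u = (a / |a|) (|b| / b) puts b on the ray of a; if a or b vanishes, u = 1 works. *)
Lemma exists_aligning_phase (a b : C) :
  exists u : C, Cmod u = 1 /\ Cmod (a + u * b) = Cmod a + Cmod b.
Proof.
destruct (Ceq_dec a 0) as [-> | Ha].
{ exists 1; split; [apply Cmod_1 |].
  now rewrite Cplus_0_l, Cmult_1_l, Cmod_0, Rplus_0_l. }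
destruct (Ceq_dec b 0) as [-> | Hb].
{ exists 1; split; [apply Cmod_1 |].
  now rewrite Cmult_0_r, Cplus_0_r, Cmod_0, Rplus_0_r. }
assert (Ha' := proj1 (Cmod_gt_0 a) Ha); assert (Hb' := proj1 (Cmod_gt_0 b) Hb).
assert (Na : RtoC (Cmod a) <> 0) by (intros H; apply RtoC_inj in H; lra).
assert (Nb : RtoC (Cmod b) <> 0) by (intros H; apply RtoC_inj in H; lra).
exists (a / Cmod a * (Cmod b / b))%C; split.
- rewrite Cmod_mult, !Cmod_div, !Cmod_R, !Rabs_pos_eq by (assumption || lra).
  field; lra.
- replace (a + a / Cmod a * (Cmod b / b) * b)%C with (a / Cmod a * (RtoC (Cmod a + Cmod b)))%C
    by (rewrite RtoC_plus; field; auto).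
  rewrite Cmod_mult, Cmod_div, !Cmod_R, !Rabs_pos_eq by (assumption || lra).
  field; lra.
Qed.

(** * Roots of unity and discrete averaging of polynomials *)

Definition cis (t : R) : C := (cos t, sin t).

Lemma cis_pow (t : R) (n : nat) : (cis t ^ n)%C = cis (INR n * t).
Proof.
induction n as [|n IHn].
- unfold cis; simpl; now rewrite Rmult_0_l, cos_0, sin_0.
- rewrite Cpow_S, IHn, S_INR; unfold cis, Cmult; simpl.
  replace ((INR n + 1) * t) with (t + INR n * t) by ring.
  rewrite cos_plus, sin_plus; f_equal; ring.
Qed.

Lemma Cmod_cis (t : R) : Cmod (cis t) = 1.
Proof.
unfold Cmod, cis; simpl fst; simpl snd.
replace (cos t ^ 2 + sin t ^ 2) with 1; [apply sqrt_1 |].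
rewrite <- (sin2_cos2 t); unfold Rsqr; ring.
Qed.

(** By cos t = 1 - 2 sin^2 (t / 2), and sin is positive at t / 2 in (0, PI). *)
Lemma cis_neq_1 (t : R) : 0 < t < 2 * PI -> cis t <> 1.
Proof.
intros Ht H; apply (f_equal fst) in H; simpl in H.
assert (H2 : cos t = 1 - 2 * sin (t / 2) * sin (t / 2)).
{ rewrite <- cos_2a_sin; f_equal; field. }
assert (0 < sin (t / 2)) by (apply sin_gt_0; lra).
nra.
Qed.

Definition zeta (N : nat) : C := cis (2 * PI / INR N).

Lemma zeta_pow_N (N : nat) : (0 < N)%nat -> (zeta N ^ N)%C = 1.
Proof.
intros HN; unfold zeta; rewrite cis_pow.
replace (INR N * (2 * PI / INR N)) with (2 * PI)
  by (field; apply not_0_INR; lia).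
unfold cis; now rewrite cos_2PI, sin_2PI.
Qed.

Lemma zeta_pow_neq_1 (N m : nat) : (0 < m < N)%nat -> (zeta N ^ m)%C <> 1.
Proof.
intros Hm; unfold zeta; rewrite cis_pow; apply cis_neq_1.
assert (0 < INR m) by (apply lt_0_INR; lia).
assert (INR m < INR N) by (apply lt_INR; lia).
pose proof PI_RGT_0.
replace (INR m * (2 * PI / INR N)) with (2 * PI * (INR m / INR N)) by (field; lra).
assert (0 < INR m / INR N < 1).
{ split; [apply Rdiv_lt_0_compat; lra | apply Rlt_div_l; lra]. }
nra.
Qed.

Lemma sum_geometric (q : C) (n : nat) :
  ((q - 1) * sum_n (fun j => q ^ j) n)%C = (q ^ S n - 1)%C.
Proof.
induction n as [|n IHn].
- rewrite sum_O; simpl; ring.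
- rewrite sum_Sn. change plus with Cplus.
  rewrite Cmult_plus_distr_l, IHn, (Cpow_S _ (S n)); ring.
Qed.

(** Orthogonality of characters: with q = zeta^m, the geometric sum times q - 1 is q^N - 1 = 0,
    while q differs from 1. *)
Lemma sum_zeta_pow_0 (N m : nat) : (0 < m < N)%nat ->
  sum_n (fun j => (zeta N ^ m) ^ j)%C (N - 1) = RtoC 0.
Proof.
intros Hm.
pose proof (sum_geometric (zeta N ^ m) (N - 1)) as H.
replace (S (N - 1)) with N in H by lia.
rewrite <- Cpow_mult_r, Nat.mul_comm, Cpow_mult_r, zeta_pow_N, Cpow_1_l in H by lia.
replace (1 - 1)%C with (RtoC 0) in H by ring.
destruct (Ceq_dec (sum_n (fun j => (zeta N ^ m) ^ j)%C (N - 1)) 0) as [E | E]; [exact E |].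
exfalso; refine (Cmult_neq_0 (zeta N ^ m - 1) _ _ E H).
intros H1; apply (zeta_pow_neq_1 N m Hm).
rewrite <- (Cplus_0_l 1), <- H1; ring.
Qed.

Lemma sum_n_C1 (n : nat) : sum_n (fun _ => RtoC 1) n = RtoC (INR (S n)).
Proof.
induction n as [|n IHn]; [now rewrite sum_O |].
rewrite sum_Sn, IHn, (S_INR (S n)), RtoC_plus; reflexivity.
Qed.

Lemma sum_n_delta (u : nat -> C) (l M : nat) : (l <= M)%nat ->
  (forall k, (k <= M)%nat -> k <> l -> u k = 0) -> sum_n u M = u l.
Proof.
intros Hl Hu.
assert (H0 : forall m, (m < l)%nat -> sum_n u m = RtoC 0).
{ induction m as [|m IHm]; intros Hm.
  - rewrite sum_O; apply Hu; lia.
  - rewrite sum_Sn, IHm, Hu by lia; apply Cplus_0_l. }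
induction M as [|M IHM].
- rewrite sum_O; f_equal; lia.
- rewrite sum_Sn; destruct (Nat.eq_dec l (S M)) as [-> | E].
  + rewrite H0 by lia; apply Cplus_0_l.
  + rewrite IHM, (Hu (S M)) by (lia || (intros; apply Hu; lia)); apply Cplus_0_r.
Qed.

Lemma sum_n_C_lin (u v w : nat -> C) (b c : C) (n : nat) :
  sum_n (fun k => u k + b * v k + c * w k)%C n
  = (sum_n u n + b * sum_n v n + c * sum_n w n)%C.
Proof.
induction n as [|n IHn]; [now rewrite !sum_O |].
rewrite !sum_Sn, IHn; change plus with Cplus; as_C_equation; ring.
Qed.

Definition poly_eval (p : nat -> C) (M : nat) (z : C) : C :=
  sum_n (fun k => p k * z ^ k)%C M.

Lemma sum_poly_eval_zeta (p : nat -> C) (M N m : nat) :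
  sum_n (fun j => poly_eval p M (zeta N ^ j) * (zeta N ^ m) ^ j)%C (N - 1)
  = sum_n (fun k => p k * sum_n (fun j => (zeta N ^ (k + m)) ^ j) (N - 1))%C M.
Proof.
transitivity (sum_n (fun j => sum_n (fun k => p k * (zeta N ^ (k + m)) ^ j)%C M) (N - 1)).
- apply sum_n_ext; intros j; unfold poly_eval.
  etransitivity; [symmetry; apply (sum_n_mult_r (K := C_Ring)) |].
  apply sum_n_ext; intros k; change mult with Cmult.
  as_C_equation.
  rewrite <- !Cpow_mult_r, Nat.mul_add_distr_r, Cpow_add_r, (Nat.mul_comm j k); ring.
- rewrite sum_n_switch; apply sum_n_ext; intros k.
  apply (sum_n_mult_l (K := C_Ring)).
Qed.

(** Discrete Fourier extraction of one coefficient: index l survives because l + m is a multiple of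
    N. Since k + m may exceed N, the vanishing of the other indices is stated through a reduced
    exponent m'. *)
Lemma sum_poly_eval_zeta_delta (p : nat -> C) (M N m l s : nat) :
  (l <= M)%nat -> (0 < N)%nat -> (l + m = s * N)%nat ->
  (forall k, (k <= M)%nat -> k <> l -> exists m', (0 < m' < N)%nat /\
     (zeta N ^ (k + m) = zeta N ^ m')%C) ->
  sum_n (fun j => poly_eval p M (zeta N ^ j) * (zeta N ^ m) ^ j)%C (N - 1)
  = (INR N * p l)%C.
Proof.
intros Hl HN Hs Hk; rewrite sum_poly_eval_zeta, (sum_n_delta _ l M Hl).
- rewrite Hs, Nat.mul_comm, Cpow_mult_r, zeta_pow_N, Cpow_1_l by exact HN.
  rewrite (sum_n_ext _ (fun _ => RtoC 1)) by apply Cpow_1_l.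
  rewrite sum_n_C1; replace (S (N - 1)) with N by lia; as_C_equation; ring.
- intros k H1 H2; destruct (Hk k H1 H2) as (m' & Hm' & ->).
  rewrite sum_zeta_pow_0 by exact Hm'; as_C_equation; ring.
Qed.

Lemma Cmod_sum_n_le (u : nat -> C) (v : nat -> R) (n : nat) :
  (forall k, Cmod (u k) <= v k) -> Cmod (sum_n u n) <= sum_n v n.
Proof.
intros H; induction n as [|n IHn]; [now rewrite !sum_O |].
rewrite !sum_Sn; eapply Rle_trans; [apply Cmod_triangle |].
apply Rplus_le_compat; auto.
Qed.

Lemma sum_n_RtoC (v : nat -> R) (n : nat) :
  sum_n (fun k => RtoC (v k)) n = RtoC (sum_n v n).
Proof.
induction n as [|n IHn]; [now rewrite !sum_O |].
rewrite !sum_Sn, IHn; symmetry; apply RtoC_plus.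
Qed.

Lemma Cconj_eq_inv (z w : C) : Cmod z = 1 -> (z * w = 1)%C -> Cconj z = w.
Proof.
intros Hz Hw.
pose proof (Cmod2_conj z) as H; rewrite Hz, pow1 in H.
transitivity (z * Cconj z * w)%C; [| now rewrite <- H, Cmult_1_l].
transitivity (Cconj z * (z * w))%C; [now rewrite Hw, Cmult_1_r | ring].
Qed.

(* Average p against the nonnegative trigonometric weight 1 + Re (u z^-n) over
   the N-th roots of unity; z^-n is written z^(N-n) to stay within powers of z. *)
Lemma poly_coef_bound (p : nat -> C) (M n : nat) (K : R) :
  (1 <= n <= M)%nat ->
  (forall z, Cmod z = 1 -> Cmod (poly_eval p M z) <= K) ->
  Cmod (p 0%nat) + Cmod (p n) / 2 <= K.
Proof.
intros Hn HK.
destruct (exists_aligning_phase (p 0%nat) (p n / 2)) as (u & Hu & Heq).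
rewrite Cmod_div, (Cmod_R 2), (Rabs_pos_eq 2) in Heq by (try (intros H; apply RtoC_inj in H); lra).
rewrite <- Heq.
(* With N > M + n and k <= M, the exponent k is a multiple of N only for k = 0, k + (N - n) only for
   k = n, and k + n never. *)
set (N := (M + n + 1)%nat).
assert (HN : 0 < INR N) by (apply lt_0_INR; lia).
set (z := fun j => (zeta N ^ j)%C).
assert (Hz : forall j, Cmod (z j) = 1).
{ intros j; unfold z; rewrite Cmod_pow; unfold zeta; rewrite Cmod_cis; apply pow1. }
set (w := fun j => 1 + Re (u * (zeta N ^ (N - n)) ^ j)).
assert (Hw : forall j, RtoC (w j) =
   (1 + (u * (zeta N ^ (N - n)) ^ j + Cconj u * (zeta N ^ n) ^ j) / 2)%C).
{ intros j; unfold w; rewrite RtoC_plus, re_alt, Cmult_conj.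
  do 4 f_equal.
  apply Cconj_eq_inv.
  - rewrite <- Cpow_mult_r; apply Hz.
  - rewrite <- Cpow_mult_l, <- Cpow_add_r.
    replace (N - n + n)%nat with N by lia.
    rewrite zeta_pow_N by lia; apply Cpow_1_l. }
assert (Hw0 : forall j, 0 <= w j).
{ intros j; unfold w.
  pose proof (re_le_Cmod (u * (zeta N ^ (N - n)) ^ j)) as H.
  rewrite Cmod_mult, Hu, <- Cpow_mult_r, Hz in H.
  rewrite <- Cpow_mult_r.
  apply Rabs_le_between in H; lra. }
(* The constant part of the weight extracts p' 0, the part in z^-n extracts u p' n / 2, and the
   conjugate part averages to 0. The polynomial p' is kept general so that the constant polynomial 1
   gives the total weight in [Hsum]. *)
assert (Hlin : forall p' : nat -> C,
  sum_n (fun j => poly_eval p' M (z j) * w j)%C (N - 1)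
  = (INR N * (p' 0%nat + u * (p' n / 2)))%C).
{ intros p'.
  rewrite (sum_n_ext _ (fun j => poly_eval p' M (z j) * (zeta N ^ 0) ^ j
     + u / 2 * (poly_eval p' M (z j) * (zeta N ^ (N - n)) ^ j)
     + Cconj u / 2 * (poly_eval p' M (z j) * (zeta N ^ n) ^ j))%C).
  2:{ intros j; rewrite Hw; as_C_equation; rewrite Cpow_1_l; field. }
  rewrite (sum_n_C_lin (fun j => poly_eval p' M (z j) * (zeta N ^ 0) ^ j)%C
    (fun j => poly_eval p' M (z j) * (zeta N ^ (N - n)) ^ j)%C
    (fun j => poly_eval p' M (z j) * (zeta N ^ n) ^ j)%C).
  unfold z.
  rewrite (sum_poly_eval_zeta_delta p' M N 0 0 0); try lia.
  2:{ intros k Hk Hk0; exists k; split; [lia | now rewrite Nat.add_0_r]. }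
  rewrite (sum_poly_eval_zeta_delta p' M N (N - n) n 1); try lia.
  2:{ intros k Hk Hkn; destruct (Nat.lt_ge_cases k n) as [H|H].
      - exists (k + (N - n))%nat; split; [lia | reflexivity].
      - exists (k - n)%nat; split; [lia |].
        replace (k + (N - n))%nat with (N + (k - n))%nat by lia.
        rewrite Cpow_add_r, zeta_pow_N by lia; ring. }
  rewrite sum_poly_eval_zeta, (sum_n_delta _ 0 M).
  2: lia.
  2:{ intros k Hk _; rewrite sum_zeta_pow_0 by lia; as_C_equation; ring. }
  rewrite sum_zeta_pow_0 by lia.
  as_C_equation; field. }
assert (Hsum : sum_n w (N - 1) = INR N).
{ apply RtoC_inj; rewrite <- sum_n_RtoC.
  transitivity (sum_n (fun j => poly_eval (fun k => if Nat.eqb k 0 then 1 else 0) M (z j) * w j)%C (N - 1)).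
  - apply sum_n_ext; intros j; unfold poly_eval.
    rewrite (sum_n_delta _ 0 M).
    + simpl; ring.
    + lia.
    + intros k _ Hk; rewrite (proj2 (Nat.eqb_neq k 0) Hk); ring.
  - rewrite Hlin; simpl.
    rewrite (proj2 (Nat.eqb_neq n 0)) by lia; field. }
assert (Hmain : Cmod (INR N * (p 0%nat + u * (p n / 2))) <= sum_n (fun j => mult K (w j)) (N - 1)).
{ rewrite <- Hlin; apply Cmod_sum_n_le; intros j.
  rewrite Cmod_mult, Cmod_R, Rabs_pos_eq by apply Hw0.
  apply Rmult_le_compat_r; [apply Hw0 | apply HK, Hz]. }
rewrite (sum_n_mult_l (K := R_Ring)) in Hmain.
change (Cmod (INR N * (p 0%nat + u * (p n / 2))) <= K * sum_n w (N - 1)) in Hmain.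
rewrite Hsum, Cmod_mult, Cmod_R, (Rabs_pos_eq (INR N)) in Hmain by lra.
rewrite Rmult_comm in Hmain; now apply Rmult_le_reg_r in Hmain.
Qed.

(** * From polynomial truncations to power series on the disk *)

Lemma pow_n_Cpow (z : C) (n : nat) : pow_n (K := C_AbsRing) z n = (z ^ n)%C.
Proof. induction n as [|n IHn]; [reflexivity |]. simpl; rewrite IHn; reflexivity. Qed.

Lemma is_pseries_poly_eval (a : nat -> C) (z l : C) :
  is_pseries (K := C_AbsRing) (V := C_NormedModule) a z l ->
  forall eps : posreal, exists m0 : nat, forall m, (m0 <= m)%nat ->
    Cmod (poly_eval a m z - l) < eps.
Proof.
intros H eps.
destruct (proj1 (filterlim_locally_ball_norm (K := C_AbsRing) (U := C_NormedModule) _ _) H eps) as [m0 Hm].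
exists m0; intros m Hle; specialize (Hm m Hle).
unfold ball_norm in Hm.
replace (poly_eval a m z) with (sum_n (fun k => scal (pow_n (K := C_AbsRing) z k) (a k)) m).
- exact Hm.
- apply sum_n_ext; intros k; rewrite pow_n_Cpow; apply Cmult_comm.
Qed.

(** Each term is a difference of consecutive partial sums, both eventually within 1 of the limit. *)
Lemma coef_eventually_le (a : nat -> C) (z l : C) :
  is_pseries (K := C_AbsRing) (V := C_NormedModule) a z l ->
  exists m0 : nat, forall k, (m0 <= k)%nat -> Cmod (a k) * Cmod z ^ k <= 2.
Proof.
intros H; destruct (is_pseries_poly_eval a z l H (mkposreal 1 Rlt_0_1)) as [m0 Hm].
exists (S m0); intros [|k] Hk; [lia |].
pose proof (Hm k ltac:(lia)) as H1; pose proof (Hm (S k) ltac:(lia)) as H2; simpl in H1, H2.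
rewrite <- Cmod_pow, <- Cmod_mult.
replace (a (S k) * z ^ S k)%C with ((poly_eval a (S k) z - l) + - (poly_eval a k z - l))%C.
- eapply Rle_trans; [apply Cmod_triangle |]; rewrite Cmod_opp; lra.
- unfold poly_eval; rewrite sum_Sn; change plus with Cplus; as_C_equation; ring.
Qed.

(** The error is the closed form of the sum of 2 q^k for M < k <= M + d, added one term at a
    time. *)
Lemma poly_eval_tail (a : nat -> C) (q : R) (m0 : nat) (z : C) (M d : nat) :
  0 < q < 1 -> (m0 <= M)%nat ->
  (forall k, (m0 <= k)%nat -> Cmod (a k * z ^ k) <= 2 * q ^ k) ->
  Cmod (poly_eval a M z) <=
    Cmod (poly_eval a (M + d) z) + 2 * (q ^ S M - q ^ S (M + d)) / (1 - q).
Proof.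
intros Hq HM Ha; induction d as [|d IHd].
- rewrite Nat.add_0_r; unfold Rdiv; rewrite Rminus_diag; lra.
- eapply Rle_trans; [exact IHd |].
  rewrite Nat.add_succ_r.
  replace (poly_eval a (M + d) z) with
    (poly_eval a (S (M + d)) z + - (a (S (M + d)) * z ^ S (M + d)))%C
    by (unfold poly_eval; rewrite sum_Sn; change plus with Cplus; as_C_equation; ring).
  pose proof (Cmod_triangle (poly_eval a (S (M + d)) z) (- (a (S (M + d)) * z ^ S (M + d)))) as Ht.
  rewrite Cmod_opp in Ht.
  pose proof (Ha (S (M + d)) ltac:(lia)).
  replace (2 * (q ^ S M - q ^ S (S (M + d))) / (1 - q))
    with (2 * (q ^ S M - q ^ S (M + d)) / (1 - q) + 2 * q ^ S (M + d)); [lra |].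
  rewrite <- (tech_pow_Rmult q (S (M + d))); field; lra.
Qed.

(** On the circle of radius rho the truncations of f are bounded by 1 plus a geometric error uniform
    in z. [poly_coef_bound] applies to each of them, and the error vanishes as M grows. *)
Lemma class_B_coef_circle (f : C -> C) (a : nat -> C) (rho : R) (n : nat) :
  class_B f -> expands_on_disk f a -> 0 < rho < 1 -> (1 <= n)%nat ->
  Cmod (a 0%nat) + Cmod (a n) * rho ^ n / 2 <= 1.
Proof.
intros [_ Hf] Ha Hrho Hn.
(* Convergence at the intermediate radius rho' bounds a_k rho'^k, hence a_k rho^k decays like q^k
   with q = rho / rho'. *)
set (rho' := (1 + rho) / 2).
set (q := rho / rho').
assert (Hrho' : rho < rho' < 1) by (unfold rho'; lra).
assert (Hq : 0 < q < 1).
{ unfold q; split; [apply Rdiv_lt_0_compat; lra | apply Rlt_div_l; lra]. }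
assert (Hmr' : Cmod rho' = rho') by (rewrite Cmod_R; apply Rabs_pos_eq; lra).
assert (Hmr : Cmod rho = rho) by (rewrite Cmod_R; apply Rabs_pos_eq; lra).
destruct (coef_eventually_le a rho' (f rho')) as [m0 Hm0].
{ apply Ha; lra. }
rewrite Hmr' in Hm0.
assert (Hb : forall k, (m0 <= k)%nat -> Cmod (a k) * rho ^ k <= 2 * q ^ k).
{ intros k Hk; replace rho with (rho' * q) by (unfold q; field; lra).
  rewrite Rpow_mult_distr, <- Rmult_assoc.
  apply Rmult_le_compat_r; [apply pow_le; lra | auto]. }
assert (Hbound : forall M, (m0 <= M)%nat -> (n <= M)%nat ->
  Cmod (a 0%nat) + Cmod (a n) * rho ^ n / 2 <= 1 + q ^ M * (2 * q / (1 - q))).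
{ intros M HM HnM.
  pose proof (poly_coef_bound (fun k => a k * rho ^ k)%C M n (1 + q ^ M * (2 * q / (1 - q)))) as H.
  cbv beta in H; rewrite !Cmod_mult, !Cmod_pow, Hmr, pow_O, Rmult_1_r in H.
  apply H; [lia |]; clear H.
  intros z Hz.
  replace (poly_eval (fun k => a k * rho ^ k)%C M z) with (poly_eval a M (rho * z)%C)
    by (apply sum_n_ext; intros k; rewrite Cpow_mult_l; as_C_equation; ring).
  (* A longer truncation, of degree M + m1, is within eps of f (rho z). Here m1 depends on z, but
     the tail between M and M + m1 is bounded independently of it. *)
  apply le_epsilon; intros eps Heps.
  assert (Hdisk : Cmod (rho * z) < 1) by (rewrite Cmod_mult, Hz, Hmr; lra).
  destruct (is_pseries_poly_eval _ _ _ (Ha _ Hdisk) (mkposreal eps Heps)) as [m1 Hm1].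
  specialize (Hm1 (M + m1)%nat ltac:(lia)); simpl in Hm1.
  pose proof (poly_eval_tail a q m0 (rho * z) M m1 Hq HM) as Ht.
  assert (Hterm : forall k, (m0 <= k)%nat -> Cmod (a k * (rho * z) ^ k) <= 2 * q ^ k).
  { intros k Hk; rewrite Cmod_mult, Cmod_pow, Cmod_mult, Hz, Hmr, Rmult_1_r; auto. }
  specialize (Ht Hterm).
  pose proof (Hf _ Hdisk).
  assert (Cmod (poly_eval a (M + m1) (rho * z)) <= 1 + eps).
  { replace (poly_eval a (M + m1) (rho * z)) with
      ((poly_eval a (M + m1) (rho * z) - f (rho * z)) + f (rho * z))%C by ring.
    eapply Rle_trans; [apply Cmod_triangle | lra]. }
  assert (2 * (q ^ S M - q ^ S (M + m1)) / (1 - q) <= q ^ M * (2 * q / (1 - q))); [| lra].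
  assert (0 <= q ^ S (M + m1)) by (apply pow_le; lra).
  replace (q ^ M * (2 * q / (1 - q))) with (2 * q ^ S M / (1 - q)) by (simpl; field; lra).
  unfold Rdiv; apply Rmult_le_compat_r; [apply Rlt_le, Rinv_0_lt_compat; lra | lra]. }
apply (is_lim_seq_le_loc (fun _ => Cmod (a 0%nat) + Cmod (a n) * rho ^ n / 2)
  (fun M => 1 + q ^ M * (2 * q / (1 - q))) (Finite _) (Finite 1)).
- exists (m0 + n)%nat; intros M HM; apply Hbound; lia.
- apply is_lim_seq_const.
- replace 1 with (1 + 0 * (2 * q / (1 - q))) at 1 by ring.
  apply is_lim_seq_plus'; [apply is_lim_seq_const |].
  apply (is_lim_seq_scal_r _ _ 0), is_lim_seq_geom.
  rewrite Rabs_pos_eq; lra.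
Qed.

(* Caratheodory-type bound; weaker than the sharp |a_n| <= 1 - |a_0|^2, but
   exactly what the Bohr sum needs. *)
Lemma class_B_coef (f : C -> C) (a : nat -> C) (n : nat) :
  class_B f -> expands_on_disk f a -> (1 <= n)%nat ->
  Cmod (a 0%nat) + Cmod (a n) / 2 <= 1.
Proof.
intros Hf Ha Hn.
(* The bound on circles is passed to the limit as rho tends to 1 from the left. *)
set (h := fun rho => Cmod (a 0%nat) + Cmod (a n) * rho ^ n / 2).
assert (Hh : continuous h 1).
{ apply (ex_derive_continuous (K := R_AbsRing) (V := R_NormedModule)).
  unfold h; auto_derive; exact I. }
replace (Cmod (a 0%nat) + Cmod (a n) / 2) with (h 1) by (unfold h; rewrite pow1; lra).
apply (filterlim_le (F := at_left 1) h (fun _ => 1) (Finite (h 1)) (Finite 1)).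
- exists (mkposreal 1 Rlt_0_1); intros y Hy Hy1.
  change (Rabs (y - 1) < 1) in Hy; apply Rabs_lt_between in Hy.
  apply (class_B_coef_circle f a y n Hf Ha); [lra | exact Hn].
- eapply filterlim_filter_le_1; [| exact Hh].
  intros P [d Hd]; exists d; auto.
- apply filterlim_const.
Qed.

(** * The Bohr radius *)

Lemma frac_coef_0 (alpha : R) : frac_coef alpha 0 = 1 / Gamma (1 - alpha).
Proof. unfold frac_coef; simpl; now rewrite Rplus_0_l, Gamma_1. Qed.

Lemma frac_coef_0_pos (alpha : R) : 0 < alpha < 1 -> 0 < frac_coef alpha 0.
Proof.
intros H; rewrite frac_coef_0; apply Rdiv_lt_0_compat; [lra |].
apply Gamma_pos; lra.
Qed.

(** The functional equation at n + 1 and at n + 1 - alpha, each written as n + x with x = 1 and x =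
    1 - alpha. *)
Lemma frac_coef_S (alpha : R) (n : nat) : 0 < alpha < 1 ->
  frac_coef alpha (S n) = (INR n + 1) / (INR n + 1 - alpha) * frac_coef alpha n.
Proof.
intros H; unfold frac_coef; rewrite S_INR.
pose proof (pos_INR n).
pose proof (Gamma_succ 1 n ltac:(lra)) as H1.
pose proof (Gamma_succ (1 - alpha) n ltac:(lra)) as H2.
pose proof (Gamma_pos_shift (1 - alpha) n ltac:(lra)) as H3.
replace (INR n + 1 + 1 - alpha) with (INR n + (1 - alpha) + 1) by ring.
replace (INR n + 1 - alpha) with (INR n + (1 - alpha)) by ring.
rewrite H1, H2; field; lra.
Qed.

Lemma frac_coef_ge (alpha : R) (n : nat) : 0 < alpha < 1 ->
  frac_coef alpha 0 <= frac_coef alpha n.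
Proof.
intros H; pose proof (frac_coef_0_pos alpha H).
induction n as [|n IHn]; [apply Rle_refl |].
rewrite frac_coef_S by exact H.
pose proof (pos_INR n).
assert (1 <= (INR n + 1) / (INR n + 1 - alpha)) by (apply Rle_div_r; lra).
nra.
Qed.

Lemma frac_coef_pos (alpha : R) (n : nat) : 0 < alpha < 1 -> 0 < frac_coef alpha n.
Proof.
intros H; pose proof (frac_coef_0_pos alpha H); pose proof (frac_coef_ge alpha n H); lra.
Qed.

(** Ratio test: consecutive coefficients have ratio 1 / (1 - alpha / (n + 1)), which tends to 1. *)
Lemma CV_radius_frac_coef (alpha : R) : 0 < alpha < 1 ->
  CV_radius (frac_coef alpha) = 1.
Proof.
intros H; rewrite <- Rinv_1; apply CV_radius_finite_DAlembert.
- intros n; apply Rgt_not_eq, frac_coef_pos, H.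
- lra.
- apply (is_lim_seq_ext (fun n => / (1 - alpha * / (INR n + 1)))).
  { intros n; pose proof (pos_INR n).
    pose proof (frac_coef_pos alpha n H).
    rewrite frac_coef_S by exact H.
    replace ((INR n + 1) / (INR n + 1 - alpha) * frac_coef alpha n / frac_coef alpha n)
      with ((INR n + 1) / (INR n + 1 - alpha)) by (field; lra).
    rewrite Rabs_pos_eq by (apply Rdiv_le_0_compat; lra).
    field; lra. }
  replace (Finite 1) with (Rbar_inv (1 - alpha * 0)) by (simpl; f_equal; field).
  apply is_lim_seq_inv.
  + apply is_lim_seq_minus'; [apply is_lim_seq_const |].
    apply (is_lim_seq_scal_l _ alpha 0).
    apply (is_lim_seq_ext (fun n => / INR (S n))).
    { intros n; now rewrite S_INR. }
    apply (is_lim_seq_inv _ p_infty); [| discriminate].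
    apply (is_lim_seq_incr_1 INR p_infty), is_lim_seq_INR.
  + intros E; injection E; lra.
Qed.

Lemma ex_series_frac_coef (alpha r : R) : 0 < alpha < 1 -> 0 <= r < 1 ->
  ex_series (fun n => frac_coef alpha n * r ^ n).
Proof.
intros H Hr.
apply (ex_series_ext (fun n => Rabs (frac_coef alpha n * r ^ n))).
- intros n; apply Rabs_pos_eq, Rmult_le_pos;
    [apply Rlt_le, frac_coef_pos, H | apply pow_le; lra].
- apply CV_disk_inside; rewrite CV_radius_frac_coef by exact H.
  simpl; rewrite Rabs_pos_eq; lra.
Qed.

Lemma ex_series_frac_coef_S (alpha r : R) : 0 < alpha < 1 -> 0 <= r < 1 ->
  ex_series (fun k => frac_coef alpha (S k) * r ^ S k).
Proof.
intros H Hr.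
apply (ex_series_incr_1 (fun n => frac_coef alpha n * r ^ n)), ex_series_frac_coef; assumption.
Qed.

Lemma exists_bohr_radius (alpha : R) : 0 < alpha < 1 ->
  exists r, is_bohr_radius alpha r.
Proof.
intros H; set (c := frac_coef alpha); set (c0 := frac_coef alpha 0).
assert (Hc0 : 0 < c0) by apply frac_coef_0_pos, H.
assert (Hhalf : 1 / (2 * Gamma (1 - alpha)) = c0 / 2).
{ unfold c0; rewrite frac_coef_0; field; apply Rgt_not_eq, Gamma_pos; lra. }
assert (Hex : forall r, 0 <= r < 1 -> ex_series (fun n => c n * r ^ n))
  by (intros; now apply ex_series_frac_coef).
assert (HexS : forall r, 0 <= r < 1 -> ex_series (fun k => c (S k) * r ^ S k))
  by (intros; now apply ex_series_frac_coef_S).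
assert (Hsplit : forall r, 0 <= r < 1 ->
  PSeries c r = c0 + Series (fun k => c (S k) * r ^ S k)).
{ intros r Hr; unfold PSeries; rewrite Series_incr_1 by auto.
  unfold c0, c; now rewrite pow_O, Rmult_1_r. }
assert (H0 : PSeries c 0 = c0) by apply PSeries_0.
(* Comparison with c0 times the geometric series of ratio 1/2, whose sum is 2. *)
assert (H1 : c0 * 2 <= PSeries c (/ 2)).
{ replace 2 with (/ (1 - / 2)) at 1 by field.
  rewrite <- Series_geom by (rewrite Rabs_pos_eq; lra).
  rewrite <- Series_scal_l; apply Series_le; [| apply Hex; lra].
  intros n; pose proof (pow_lt (/ 2) n ltac:(lra)).
  pose proof (frac_coef_ge alpha n H) as Hge; fold c c0 in Hge.
  split; [nra |]; apply Rmult_le_compat_r; [lra | assumption]. }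
(* [PSeries c] includes the term n = 0, so the target c0 / 2 for the tail becomes c0 + c0 / 2. It
   lies between the values c0 at 0 and at least 2 c0 at 1/2. *)
destruct (Ranalysis5.f_interv_is_interv (PSeries c) 0 (/ 2) (c0 * (3 / 2)))
  as (R0 & HR0 & HP).
- lra.
- rewrite H0; lra.
- intros x Hx; apply PSeries_continuity.
  unfold c; rewrite CV_radius_frac_coef by exact H.
  simpl; rewrite Rabs_pos_eq; lra.
- assert (HR0' : R0 <> 0) by (intros ->; lra).
  assert (HR : 0 < R0 < 1) by lra.
  rewrite Hsplit in HP by lra.
  assert (Heq : is_series (fun k => c (S k) * R0 ^ S k) (c0 / 2)).
  { replace (c0 / 2) with (Series (fun k => c (S k) * R0 ^ S k)) by lra.
    apply Series_correct, HexS; lra. }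
  exists R0; split; [exact HR |]; split.
  + unfold radius_equation; rewrite Hhalf; exact Heq.
  + intros s Hs Hseq; unfold radius_equation in Hseq; rewrite Hhalf in Hseq; fold c in Hseq.
    apply Rnot_lt_le; intros Hlt.
    (* For s < R0, s^(k+1) <= (s / R0) R0^(k+1) termwise. The factor s / R0 < 1 then makes the sum
       at s strictly smaller than c0 / 2, which is the contradiction. *)
    assert (Hle : c0 / 2 <= s / R0 * (c0 / 2)).
    { rewrite <- (is_series_unique _ _ Hseq) at 1.
      rewrite <- (is_series_unique _ _ Heq), <- Series_scal_l.
      assert (Hq : 0 < s / R0) by (apply Rdiv_lt_0_compat; lra).
      apply Series_le.
      2:{ apply (ex_series_scal (K := R_AbsRing) (V := R_NormedModule) (s / R0) (fun k => c (S k) * R0 ^ S k)); eexists; exact Heq. }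
      intros k; pose proof (frac_coef_pos alpha (S k) H) as Hck; fold c in Hck.
      assert (Hsk : s ^ k <= R0 ^ k) by (apply pow_incr; lra).
      pose proof (pow_lt s k ltac:(lra)).
      split.
      - apply Rmult_le_pos; [lra | apply pow_le; lra].
      - replace (s / R0 * (c (S k) * R0 ^ S k)) with (c (S k) * s * R0 ^ k)
          by (simpl; field; lra).
        simpl; rewrite <- Rmult_assoc.
        apply Rmult_le_compat_l; [nra | exact Hsk]. }
    assert (s / R0 < 1) by (apply Rlt_div_l; lra).
    nra.
Qed.

Theorem theorem3p1 (alpha : R) (halpha : 0 < alpha < 1) :
  exists R0 : R, is_bohr_radius alpha R0 /\
    forall (f : C -> C) (a : nat -> C),
      class_B f -> expands_on_disk f a ->
      forall r : R, 0 < r <= R0 ->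
        ex_series (fun n : nat =>
          frac_coef alpha n * Cmod (a n) * Rpower r (INR n - alpha)) /\
        Series (fun n : nat =>
          frac_coef alpha n * Cmod (a n) * Rpower r (INR n - alpha))
          <= Rpower r (- alpha) / Gamma (1 - alpha).
Proof.
destruct (exists_bohr_radius alpha halpha) as (R0 & HR0).
exists R0; split; [exact HR0 |].
destruct HR0 as (HR & Heq & _).
intros f a Hf Ha r Hr.
unfold radius_equation in Heq; set (c := frac_coef alpha) in *.
assert (Hc : forall n, 0 < c n) by (intros n; now apply frac_coef_pos).
set (A := Cmod (a 0%nat)); set (B := 2 * (1 - A)).
assert (Hcoef : forall n, Cmod (a (S n)) <= B).
{ intros n; pose proof (class_B_coef f a (S n) Hf Ha ltac:(lia)); unfold B, A; lra. }
assert (HB : 0 <= B) by (eapply Rle_trans; [apply Cmod_ge_0 | apply (Hcoef 0%nat)]).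
(* Factoring out r^-alpha leaves a series in natural powers of r. *)
set (u := fun n => c n * Cmod (a n) * r ^ n).
assert (Hterm : forall n, Rpower r (- alpha) * u n
   = c n * Cmod (a n) * Rpower r (INR n - alpha)).
{ intros n; unfold u, Rminus.
  rewrite Rplus_comm, Rpower_plus, Rpower_pow by lra; ring. }
assert (HuS : forall n, 0 <= u (S n) <= B * (c (S n) * r ^ S n)).
{ intros n; unfold u.
  pose proof (Cmod_ge_0 (a (S n))); pose proof (Hcoef n); pose proof (Hc (S n)).
  assert (0 < r ^ S n) by (apply pow_lt; lra).
  split.
  - apply Rmult_le_pos; [apply Rmult_le_pos |]; lra.
  - replace (c (S n) * Cmod (a (S n)) * r ^ S n)
      with (Cmod (a (S n)) * (c (S n) * r ^ S n)) by ring.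
    apply Rmult_le_compat_r; [apply Rmult_le_pos |]; lra. }
assert (HexB : ex_series (fun n => B * (c (S n) * r ^ S n))).
{ apply (ex_series_scal (K := R_AbsRing) (V := R_NormedModule) B (fun n => c (S n) * r ^ S n)), ex_series_frac_coef_S; lra. }
assert (Hexu : ex_series u).
{ apply ex_series_incr_1, (ex_series_le (K := R_AbsRing) (V := R_CompleteNormedModule) _ _)
    with (2 := HexB).
  intros n; change (Rabs (u (S n)) <= B * (c (S n) * r ^ S n)).
  rewrite Rabs_pos_eq; apply HuS. }
split.
- apply (ex_series_ext _ _ Hterm), (ex_series_scal (K := R_AbsRing) (V := R_NormedModule) (Rpower r (- alpha)) u), Hexu.
- rewrite <- (Series_ext _ _ Hterm), Series_scal_l.
  replace (Rpower r (- alpha) / Gamma (1 - alpha)) with (Rpower r (- alpha) * c 0%nat)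
    by (unfold c; rewrite frac_coef_0; unfold Rdiv; ring).
  apply Rmult_le_compat_l; [apply Rlt_le, exp_pos |].
  rewrite Series_incr_1 by exact Hexu.
  (* Monotonicity in r: the tail at r is at most the tail at R0, which the radius equation fixes at
     c_0 / 2. *)
  assert (Hr0 : Series (fun k => c (S k) * r ^ S k) <= c 0%nat / 2).
  { replace (c 0%nat / 2) with (1 / (2 * Gamma (1 - alpha))).
    2:{ unfold c; rewrite frac_coef_0; field; apply Rgt_not_eq, Gamma_pos; lra. }
    rewrite <- (is_series_unique _ _ Heq); apply Series_le; [| eexists; exact Heq].
    intros k; pose proof (Hc (S k)).
    split; [apply Rmult_le_pos; [lra | apply pow_le; lra] |].
    apply Rmult_le_compat_l; [lra | apply pow_incr; lra]. }
  assert (Htail : Series (fun k => u (S k)) <= B * Series (fun k => c (S k) * r ^ S k)).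
  { rewrite <- Series_scal_l; now apply Series_le. }
  unfold u at 1; fold A; rewrite pow_O.
  (* The total is at most c_0 A + 2 (1 - A) c_0 / 2 = c_0; [HB] lets the tail bound be multiplied by
     B. *)
  pose proof (Hc 0%nat); unfold B in *; nra.
Qed.
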